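(* Let $\mathscr{H}$ be a real Hilbert space, let $A:\mathscr{H}\to 2^{\mathscr{H}}$ be maximal monotone, let $B:\mathscr{H}\to\mathscr{H}$ be monotone and $L$-Lipschitz continuous for some $L>0$, and suppose that $\Omega:=\{x\in\mathscr{H}:\mathbf{0}\in A(x)+B(x)\}$ is nonempty. Suppose further that: (i) $\{\alpha_n\}_{n\ge1},\{\sigma_n\}_{n\ge1}\subset(0,1)$ satisfy $\alpha_n\to0$ and $\sum_{n=1}^\infty\alpha_n=+\infty$, and there are $a,b>0$ such that $\sigma_n\in(a,b)\subset(0,1-\alpha_n)$ for all $n\ge 1$; (ii) $\{\varepsilon_n\}_{n\ge1},\{\varepsilon_n'\}_{n\ge1}\subset(0,\infty)$ satisfy $\varepsilon_n\le\varepsilon_n'$ for all $n$ and $\sum_{n=1}^\infty\frac{\varepsilon_n'}{\alpha_n}<+\infty$; (iii) the constants $\bar\beta,\bar\theta$ satisfy $0\le\bar\beta\le\bar\theta\le1$. Then any sequence $\{x_n\}$ generated by Algorithm DIPCM (described in the context) converges strongly (in norm) to $x^\ast=P_\Omega(\mathbf{0})$, the metric projection of $\mathbf{0}$ onto $\Omega$ (the minimum-norm element of $\Omega$).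
   Context: For $\lambda>0$, the resolvent of a maximal monotone operator $A$ is the single-valued map $J^A_\lambda:=(I+\lambda A)^{-1}:\mathscr{H}\to\mathscr{H}$. Algorithm DIPCM. Choose $\mu\in(0,1)$, $\gamma\in(0,2)$, $\lambda_1>0$, a nonnegative real sequence $\{\xi_n\}_{n\ge1}$ with $\sum_{n=1}^\infty\xi_n<+\infty$, and starting points $x_0,x_1\in\mathscr{H}$ (all arbitrary subject to these constraints). For $n=1,2,\dots$ define the inertial parameters $$\beta_n'=\begin{cases}\min\left\{\bar\beta,\dfrac{\varepsilon_n}{\|x_n-x_{n-1}\|},\dfrac{\varepsilon_n}{\|x_n-x_{n-1}\|^2}\right\},&x_n\ne x_{n-1},\\ \bar\beta,&\text{otherwise,}\end{cases}$$ $$\theta_n=\begin{cases}\min\left\{\bar\theta,\dfrac{\varepsilon_n'}{\|x_n-x_{n-1}\|},\dfrac{\varepsilon_n'}{\|x_n-x_{n-1}\|^2}\right\},&x_n\ne x_{n-1},\\ \bar\theta,&\text{otherwise,}\end{cases}$$ and compute $$z_n=x_n+\beta_n'(x_n-x_{n-1}),\qquad w_n=x_n+\theta_n(x_n-x_{n-1}),\qquad y_n=J^A_{\lambda_n}\big(w_n-\lambda_nB(w_n)\big).$$ If $y_n=w_n$, stop ($y_n\in\Omega$). Otherwise set $$d_n=w_n-y_n-\lambda_n\big(B(w_n)-B(y_n)\big),\qquad \eta_n=\begin{cases}\dfrac{\langle w_n-y_n,d_n\rangle}{\|d_n\|^2},&d_n\neq0,\\ 0,&d_n=0,\end{cases}$$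 $$u_n=w_n-\gamma\eta_nd_n,\qquad x_{n+1}=(1-\alpha_n-\sigma_n)z_n+\sigma_nu_n,$$ and update $$\lambda_{n+1}=\begin{cases}\min\left\{\dfrac{\mu\|w_n-y_n\|}{\|B(w_n)-B(y_n)\|},\ \lambda_n+\xi_n\right\},&B(w_n)\neq B(y_n),\\ \lambda_n+\xi_n,&\text{otherwise.}\end{cases}$$ Statements about the generated sequence $\{x_n\}$ concern infinite runs, i.e. the case in which the algorithm never stops ($y_n\ne w_n$ for all $n\ge1$). *)

(* Defs.v *)
From HB Require Import structures.
From mathcomp Require Export all_boot all_order all_algebra.
From mathcomp Require Export all_classical all_reals all_analysis.

Set Implicit Arguments.
Unset Strict Implicit.
Unset Printing Implicit Defensive.

Import Order.TTheory GRing.Theory Num.Theory.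
Import numFieldNormedType.Exports.

Local Open Scope classical_set_scope.
Local Open Scope ring_scope.

(* A real Hilbert space is a complete normed module [H] with an inner product
   [dot : {dot H for idfun}] inducing its norm: [dot x x = `|x| ^+ 2].
   Set-valued operators [H -> 2^H] are functions [A : H -> set H]; [A x u]
   reads [u \in A(x)]. *)

Section Operators.
Variables (R : realType) (H : completeNormedModType R).
Variable dot : {dot H for idfun}.
Implicit Types (A : H -> set H) (B : H -> H).

Definition monotone_op A : Prop :=
  forall x y u v, A x u -> A y v -> 0 <= dot (x - y) (u - v).

Definition maximal_monotone A : Prop :=
  monotone_op A /\
  forall A', monotone_op A' ->
    (forall x, A x `<=` A' x) -> forall x, A' x `<=` A x.

Definition monotone_map B : Prop :=
  forall x y, 0 <= dot (x - y) (B x - B y).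

End Operators.

Section Splitting.
Variables (R : realType) (H : completeNormedModType R).
Implicit Types (A : H -> set H) (B : H -> H) (x y z : H).

Definition zeros A B : set H := [set x | exists2 u, A x u & u + B x = 0].

(* The values of the set-valued inverse of [I + lam A]. *)
Definition resolvent_set A (lam : R) z : set H :=
  [set y | exists2 u, A y u & y + lam *: u = z].

(* [(I + lam A)^{-1}] as a map [H -> H].  By Minty's theorem [resolvent_set]
   is a singleton when [A] is maximal monotone and [0 < lam]; the default
   value [0] is only used outside that case. *)
Definition resolvent A (lam : R) z : H := xget 0 (resolvent_set A lam z).

Definition nearest_points (S : set H) z : set H :=
  [set p | S p /\ forall q, S q -> `|z - p| <= `|z - q|].

(* [bar] is the cap, [e] the tolerance, [x'] the previous iterate. *)
Definition inertial_weight (bar e : R) x x' : R :=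
  if x == x' then bar
  else Num.min bar (Num.min (e / `|x - x'|) (e / `|x - x'| ^+ 2)).

Definition next_stepsize B (mu lam xi : R) w y : R :=
  if B w == B y then lam + xi
  else Num.min (mu * `|w - y| / `|B w - B y|) (lam + xi).

Definition descent_coef (dot : {dot H for idfun}) w y d : R :=
  if d == 0 then 0 else dot (w - y) d / `|d| ^+ 2.

End Splitting.

(* Main.v *)
(* For p in Omega and large n the relaxed step satisfies
   |u_n - p|^2 <= |w_n - p|^2 - c |w_n - y_n|^2, which gives
     |x_{n+1} - p|^2 <= (1 - alpha_n) |x_n - p|^2 + 2 alpha_n <p, p - x_{n+1}>
                        - c' |w_n - y_n|^2 + (summable inertial errors).
   Take p of minimal norm.  When |w_n - y_n| is not small the descent term beats
   the alpha_n-terms; when it is small, y_n is an approximate zero of A + B and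
   <p, p - x_{n+1}> is almost nonpositive.  Either way, for every rho > 0,
     |x_{n+1} - p|^2 <= (1 - alpha_n) |x_n - p|^2 + alpha_n rho
   eventually, and the divergence of the series of alpha_n concludes.

   Weak compactness is avoided throughout.  Minty's theorem is obtained by
   minimising a strongly convex perturbation of the Fitzpatrick function.  The
   Tikhonov path 0 in t q + A q + B q is a Cauchy sequence as t -> 0 because |q|
   is monotone and bounded; its limit is the minimum-norm zero p, and
   monotonicity at a point of the path bounds <p, p - y> from above for
   approximate zeros y. *)
From HB Require Import structures.
From mathcomp Require Import ring lra.
Require Import Defs.

Set Implicit Arguments.
Unset Strict Implicit.
Unset Printing Implicit Defensive.

Import Order.TTheory GRing.Theory Num.Theory.
Import numFieldNormedType.Exports.

Local Open Scope classical_set_scope.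
Local Open Scope ring_scope.

(** * Calculus of a real inner product, Cauchy-Schwarz *)

Section InnerProduct.
Variables (R : realType) (H : completeNormedModType R).
Variable dot : {dot H for idfun}.
Hypothesis dot_norm : forall x : H, dot x x = `|x| ^+ 2.
Implicit Types (x y z : H) (c : R).

Lemma dotC x y : dot x y = dot y x.
Proof. by rewrite hermC /= expr0 mul1r. Qed.
Lemma dotDl x y z : dot (x + y) z = dot x z + dot y z.
Proof. exact: linearDl. Qed.
Lemma dotNl x y : dot (- x) y = - dot x y.
Proof. exact: linearNl. Qed.
Lemma dotZl c x y : dot (c *: x) y = c * dot x y.
Proof. exact: linearZl_LR. Qed.
Lemma dotDr x y z : dot x (y + z) = dot x y + dot x z.
Proof. exact: linearDr. Qed.
Lemma dotNr x y : dot x (- y) = - dot x y.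
Proof. exact: linearNr. Qed.
Lemma dotZr c x y : dot x (c *: y) = c * dot x y.
Proof. exact: linearZr_LR. Qed.
Lemma dot0l x : dot 0 x = 0. Proof. exact: linear0l. Qed.
Lemma dot0r x : dot x 0 = 0. Proof. exact: linear0r. Qed.
Definition dotE := (dotDl, dotDr, dotNl, dotNr, dotZl, dotZr, dot0l, dot0r).

Lemma dot_ge0 x : 0 <= dot x x.
Proof. by rewrite dot_norm sqr_ge0. Qed.

Lemma dot_CauchySchwarz x y : `|dot x y| <= `|x| * `|y|.
Proof.
have [->|y0] := eqVneq y 0; first by rewrite dot0r !normr0 mulr0.
have yp : 0 < `|y| ^+ 2 by rewrite exprn_gt0 ?normr_gt0.
rewrite -(@ler_pXn2r _ 2) ?nnegrE ?mulr_ge0// real_normK ?num_real// exprMn.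
have := dot_ge0 (`|y| ^+ 2 *: x - dot x y *: y).
rewrite !dotE (dotC y x) !dot_norm.
set n := `|y| ^+ 2 in yp *; set m := `|x| ^+ 2; set p := dot x y => h.
have {}h : 0 <= n * (m * n - p ^+ 2) by lra.
by move: h; rewrite pmulr_rge0// subr_ge0.
Qed.

End InnerProduct.

(** * Cauchy sequences and continuity of the inner product *)

Section Convergence.
Variables (R : realType) (H : completeNormedModType R).
Variable dot : {dot H for idfun}.
Hypothesis dot_norm : forall x : H, dot x x = `|x| ^+ 2.

(** The bound [e i + e j] fits two uses: minimising sequences of a strongly convex function, and
    paths whose squared norms increase to a limit, [e] being the gap to that limit. *)
Lemma sqdist_cvgn (u : nat -> H) (e : nat -> R) :
  e n @[n --> \oo] --> (0 : R) ->
  (forall i j, `|u i - u j| ^+ 2 <= e i + e j) -> cvgn u.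
Proof.
move=> e0 ue; apply/cauchy_cvgP/cauchy_exP => r r0.
have r20 : 0 < r ^+ 2 / 2 by rewrite divr_gt0 ?exprn_gt0.
have /cvgrPdist_lt/(_ _ r20)[N _ eN] := e0.
exists (u N); exists N => // n Nn /=; rewrite -ball_normE /=.
rewrite -(@ltr_pXn2r _ 2) ?nnegrE ?(ltW r0)//.
apply: le_lt_trans (ue _ _) _.
have := eN _ (leqnn N); have := eN _ Nn => /=.
rewrite !sub0r !normrN => h1 h2.
have := ler_norm (e n); have := ler_norm (e N).
lra.
Qed.

Lemma cvg_dot (u v : nat -> H) (l m : H) :
  u n @[n --> \oo] --> l -> v n @[n --> \oo] --> m ->
  dot (u n) (v n) @[n --> \oo] --> dot l m.
Proof.
have polar x y : dot x y = 4^-1 * (`|x + y| * `|x + y| - `|x - y| * `|x - y|).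
  by rewrite -!expr2 -!dot_norm !(dotE dot) (dotC dot y x); lra.
move=> ul vm; rewrite polar; under eq_fun do rewrite polar.
by apply: cvgMl_tmp; apply: cvgB; apply: cvgM; apply: cvg_norm;
  [apply: cvgD|apply: cvgD|apply: cvgB|apply: cvgB].
Qed.

End Convergence.

(** * Minty's theorem and the resolvent *)

Section Minty.
Variables (R : realType) (H : completeNormedModType R).
Variable dot : {dot H for idfun}.
Hypothesis dot_norm : forall x : H, dot x x = `|x| ^+ 2.
Implicit Types (A : H -> set H) (x y u v z : H).

(** Adjoining the pair [(x, u)] to the graph keeps it monotone, so maximality puts the pair in the
    graph already. *)
Lemma maximal_monotone_mem A x u : maximal_monotone dot A ->
  (forall y v, A y v -> 0 <= dot (x - y) (u - v)) -> A x u.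
Proof.
move=> [Am Amax] xu.
apply: (Amax (fun y v => A y v \/ (y = x /\ v = u))); last by right.
- move=> y y' v v' [Ay|[-> ->]] [Ay'|[-> ->]]; first exact: Am.
  + by rewrite -(opprB x y) -(opprB u v) (dotNl dot) (dotNr dot) opprK; exact: xu.
  + exact: xu.
  + by rewrite subrr (dot0l dot).
- by move=> y v; left.
Qed.

(** Reduces the resolvent equation to [minty_zero]: [- p = lam *: u - z] says [p + lam *: u = z]. *)
Lemma maximal_monotone_scale A (lam : R) z : 0 < lam ->
  maximal_monotone dot A ->
  maximal_monotone dot (fun x => [set v | exists2 u, A x u & v = lam *: u - z]).
Proof.
move=> lam0 Amm; split.
  move=> x y _ _ [u Axu ->] [v Ayv ->].
  have -> : lam *: u - z - (lam *: v - z) = lam *: (u - v).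
    by rewrite opprB addrA subrK scalerBr.
  rewrite (dotZr dot) mulr_ge0 ?(ltW lam0)//; exact: (Amm.1 _ _ _ _ Axu Ayv).
move=> A' A'm AA' x v A'xv; exists (lam^-1 *: (v + z)); last first.
  by rewrite scalerA divff ?gt_eqF// scale1r addrK.
apply: (maximal_monotone_mem Amm) => y w Ayw.
have := A'm x y v (lam *: w - z) A'xv (AA' _ _ (ex_intro2 _ _ w Ayw erefl)).
have -> : v - (lam *: w - z) = lam *: (lam^-1 *: (v + z) - w).
  by rewrite scalerBr scalerA divff ?gt_eqF// scale1r opprB addrA.
by rewrite (dotZr dot) pmulr_rge0.
Qed.

(* The constraint on [(x, u, t)] below says that [t] bounds the Fitzpatrick
   function of [A] at [(x, u)]; its strongly convex perturbation by half the
   squared norm is minimised directly, by a Cauchy sequence. *)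
Lemma minty_zero A : maximal_monotone dot A -> exists p, A p (- p).
Proof.
move=> Amm; have Am := Amm.1.
pose C x u (t : R) := forall y v, A y v -> dot x v + dot y u - dot y v <= t.
pose phi x u (t : R) := 2 * t + dot x x + dot u u.
(* If [t < dot x u], the constraint makes [(x, u)] monotonically related to the graph, hence a point
   of it; the constraint tested there contradicts [t < dot x u]. *)
have Cge x u t : C x u t -> dot x u <= t.
  move=> Cxu; rewrite leNgt; apply/negP => tlt.
  have Axu : A x u.
    apply: (maximal_monotone_mem Amm) => y v Ayv; have := Cxu _ _ Ayv.
    rewrite !(dotE dot) => h; lra.
  have := Cxu _ _ Axu; lra.
have C_graph y v : A y v -> C y v (dot y v).
  move=> Ayv y' v' Ay'v'; have := Am _ _ _ _ Ayv Ay'v'.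
  rewrite !(dotE dot); lra.
have [y0 [v0 A0]] : exists y v, A y v.
  have [[y [v ?]]|nA] := pselect (exists y v, A y v); first by exists y, v.
  have A00 : A 0 0.
    by apply: (maximal_monotone_mem Amm) => y v Ayv; case: nA; exists y, v.
  by exists 0, 0.
have phi_ge0 x u t : C x u t -> 0 <= phi x u t.
  move=> /Cge xut; rewrite /phi; have := dot_ge0 dot_norm (x + u).
  rewrite !(dotE dot) (dotC dot u x); lra.
pose S : set R := [set r | exists x u t, C x u t /\ r = phi x u t].
have Sinf : has_inf S.
  split.
    exists (phi y0 v0 (dot y0 v0)), y0, v0, (dot y0 v0).
    by split; [exact: C_graph|].
  by exists 0 => _ [x [u [t [Cxu ->]]]]; exact: phi_ge0.
set m := inf S.
have m_le x u t : C x u t -> m <= phi x u t.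
  by move=> Cxu; apply: (ge_inf Sinf.2); exists x, u, t.
have ex n : exists q : H * H * R, C q.1.1 q.1.2 q.2 /\ phi q.1.1 q.1.2 q.2 < m + harmonic n.
  have [_ [x [u [t [Cxu ->]]]] lt] := inf_adherent (harmonic_gt0 n) Sinf.
  by exists (x, u, t).
have [q qP] := choice ex.
pose X n := (q n).1.1; pose U n := (q n).1.2; pose T n := (q n).2.
have CX n : C (X n) (U n) (T n) := (qP n).1.
have phiX n : phi (X n) (U n) (T n) < m + harmonic n := (qP n).2.
(* The midpoint of two near-minimisers is again feasible, so its value is at least [m]; the
   parallelogram identity turns this into a distance bound. *)
have dist i j : dot (X i - X j) (X i - X j) + dot (U i - U j) (U i - U j) <=
    2 * harmonic i + 2 * harmonic j.
  have Cmid : C (2^-1 *: (X i + X j)) (2^-1 *: (U i + U j)) (2^-1 * (T i + T j)).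
    move=> y v Ayv; have := CX i _ _ Ayv; have := CX j _ _ Ayv.
    rewrite !(dotE dot); lra.
  have := m_le _ _ _ Cmid; have := phiX i; have := phiX j; rewrite /phi.
  rewrite !(dotE dot) (dotC dot (X j) (X i)) (dotC dot (U j) (U i)); lra.
have e0 : (2 * harmonic n : R) @[n --> \oo] --> (0 : R).
  by rewrite -(mulr0 2); apply: cvgMl_tmp; exact: cvg_harmonic.
have /cvg_ex[/= x Xx] : cvgn X.
  apply: (sqdist_cvgn e0) => i j; rewrite -dot_norm.
  by apply: le_trans (dist i j); rewrite lerDl dot_ge0.
have /cvg_ex[/= u Uu] : cvgn U.
  apply: (sqdist_cvgn e0) => i j; rewrite -dot_norm.
  by apply: le_trans (dist i j); rewrite lerDr dot_ge0.
(* The value of [t] for which [phi x u t = m]. *)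
pose t := 2^-1 * (m - dot x x - dot u u).
have Cxut : C x u t.
  move=> y v Ayv.
  apply: (@ler_cvg_to _ (nbhs \oo) _ _ (fun n => dot (X n) v + dot y (U n) - dot y v)
    (fun n => 2^-1 * (m + harmonic n - dot (X n) (X n) - dot (U n) (U n)))).
  - apply: cvgB; last exact: cvg_cst.
    by apply: cvgD; apply: (cvg_dot dot_norm) => //; exact: cvg_cst.
  - apply: cvgMl_tmp; apply: cvgB; last exact: (cvg_dot dot_norm).
    apply: cvgB; last exact: (cvg_dot dot_norm).
    rewrite -[m in X in _ --> X]addr0; apply: cvgD; [exact: cvg_cst|exact: cvg_harmonic].
  - apply: nearW => n; have := CX n _ _ Ayv; have := phiX n; rewrite /phi; lra.
(* first-order optimality of [(x, u, t)] in the direction of a graph point *)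
have opt y v : A y v -> 0 <= dot y v - t + dot x (y - x) + dot u (v - u).
  move=> Ayv; set D := (X in 0 <= X).
  pose K := dot (y - x) (y - x) + dot (v - u) (v - u).
  have K0 : 0 <= K by rewrite addr_ge0 ?dot_ge0.
  have seg s : 0 < s -> s <= 1 -> 0 <= 2 * D + s * K.
    move=> s0 s1.
    have Cs : C (x + s *: (y - x)) (u + s *: (v - u)) (t + s * (dot y v - t)).
      move=> y' v' Ay'v'.
      have h1 := Cxut _ _ Ay'v'; have h2 := C_graph _ _ Ayv _ _ Ay'v'.
      have h3 : 0 <= (1 - s) * (t - (dot x v' + dot y' u - dot y' v')).
        by rewrite mulr_ge0 ?subr_ge0.
      have h4 : 0 <= s * (dot y v - (dot y v' + dot y' v - dot y' v')).
        by rewrite mulr_ge0 ?subr_ge0// ltW.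
      rewrite !(dotE dot); lra.
    have := m_le _ _ _ Cs; rewrite /phi => h.
    have : 0 <= s * (2 * D + s * K).
      move: h; rewrite /D /K; move: (y - x) (v - u) => e f.
      rewrite !(dotE dot) (dotC dot e x) (dotC dot f u).
      have : 2 * t = m - dot x x - dot u u by rewrite /t; lra.
      lra.
    by rewrite pmulr_rge0.
  rewrite leNgt; apply/negP => D0.
  have K1 : 0 < K + 1 by lra.
  (* This step length gives [s * K <= - D], hence [2 * D + s * K <= D < 0]. *)
  have := seg (Num.min 1 (- D / (K + 1))).
  rewrite lt_min ltr01 divr_gt0 ?oppr_gt0// ge_min lexx => /(_ isT isT).
  have : Num.min 1 (- D / (K + 1)) * K <= - D / (K + 1) * (K + 1).
    apply: (@le_trans _ _ (- D / (K + 1) * K)).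
      by rewrite ler_wpM2r// ge_min lexx orbT.
    by rewrite ler_wpM2l ?lerDl// divr_ge0 ?oppr_ge0 ?ltW.
  rewrite divfK ?gt_eqF//; lra.
have xut := Cge _ _ _ Cxut.
(* Optimality together with [dot x u <= t]. The right side is also [dot (- u - y) (- x - v)], so
   [(- u, - x)] belongs to the graph; taken as [(y, v)] it forces [x + u = 0]. *)
have ineq y v : A y v -> dot (x + u) (x + u) <= dot (y + u) (v + x).
  move=> /opt; rewrite !(dotE dot) (dotC dot u x) (dotC dot y x); lra.
have Aux : A (- u) (- x).
  apply: (maximal_monotone_mem Amm) => y v /ineq.
  move=> /(le_trans (dot_ge0 dot_norm _)); rewrite !(dotE dot); lra.
exists (- u); rewrite opprK.
have := ineq _ _ Aux; rewrite addNr (dot0l dot) dot_norm => h.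
have /eqP : `|x + u| ^+ 2 = 0 by apply/eqP; rewrite eq_le h sqr_ge0.
by rewrite sqrf_eq0 normr_eq0 addr_eq0 => /eqP xu; rewrite xu opprK in Aux.
Qed.

Lemma resolvent_spec A (lam : R) z : maximal_monotone dot A -> 0 < lam ->
  exists2 u, A (resolvent A lam z) u & resolvent A lam z + lam *: u = z.
Proof.
move=> Amm lam0.
have [p [u Apu pu]] := minty_zero (maximal_monotone_scale z lam0 Amm).
have : resolvent_set A lam z p.
  by exists u => //; rewrite -[lam *: u](subrK z) -pu addrA subrr add0r.
by move=> /(@xgetI _ 0 _ _).
Qed.

End Minty.

(** * Tikhonov regularisation and the minimum-norm zero *)

Section Regularization.
Variables (R : realType) (H : completeNormedModType R).
Variable dot : {dot H for idfun}.
Hypothesis dot_norm : forall x : H, dot x x = `|x| ^+ 2.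
Implicit Types (A : H -> set H) (x y u v z : H).

Lemma maximal_monotone_closed A (x u : nat -> H) (p v : H) :
  maximal_monotone dot A -> (forall n, A (x n) (u n)) ->
  x n @[n --> \oo] --> p -> u n @[n --> \oo] --> v -> A p v.
Proof.
move=> Amm Axu xp uv; apply: (maximal_monotone_mem Amm) => y w Ayw.
apply: (@ler_cvg_to _ (nbhs \oo) _ _ (fun=> 0) (fun n => dot (x n - y) (u n - w))).
- exact: cvg_cst.
- by apply: (cvg_dot dot_norm); apply: cvgB => //; exact: cvg_cst.
- by apply: nearW => n; exact: (Amm.1).
Qed.

Lemma resolvent_nonexpansive A (lam : R) x y : maximal_monotone dot A -> 0 < lam ->
  `|resolvent A lam x - resolvent A lam y| <= `|x - y|.
Proof.
move=> Amm lam0.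
have [u Au ux] := resolvent_spec dot_norm x Amm lam0.
have [v Av vy] := resolvent_spec dot_norm y Amm lam0.
move: (resolvent A lam x) (resolvent A lam y) Au ux Av vy => p q Apu <- Aqv <-.
rewrite -(@ler_pXn2r _ 2) ?nnegrE// -!dot_norm.
have := Amm.1 _ _ _ _ Apu Aqv => mon.
have h1 : 0 <= lam * dot (p - q) (u - v) by rewrite mulr_ge0 ?(ltW lam0).
have h2 := dot_ge0 dot_norm (lam *: (u - v)).
have -> : p + lam *: u - (q + lam *: v) = (p - q) + lam *: (u - v).
  by rewrite scalerBr opprD addrACA.
move: h1 h2; move: (p - q) (u - v) => e f.
rewrite !(dotE dot) (dotC dot f e); lra.
Qed.

Variables (A : H -> set H) (B : H -> H) (L : R).
Hypothesis A_maxmon : maximal_monotone dot A.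
Hypothesis B_mon : monotone_map dot B.
Hypothesis L_gt0 : 0 < L.
Hypothesis B_lip : L.-lipschitz B.

Lemma lipschitz_norm x y : `|B x - B y| <= L * `|x - y|.
Proof. exact: (@B_lip (x, y)). Qed.

(* Solutions are the fixed points of the forward-backward map with step [s],
   and [t + B] is [t]-strongly monotone and [(t + L)]-Lipschitz. *)
Lemma regularized_solution (t : R) : 0 < t ->
  exists q, A q (- (t *: q) - B q).
Proof.
move=> t0; pose K := t + L; have K0 : 0 < K by rewrite addr_gt0.
(* This [s] minimises [1 - 2 * s * t + s ^+ 2 * K ^+ 2], which bounds the squared Lipschitz constant
   of [G]; the minimum is [rho]. *)
pose s := t / K ^+ 2; have s0 : 0 < s by rewrite divr_gt0 ?exprn_gt0.
pose G q := q - s *: (t *: q + B q).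
pose rho := 1 - t ^+ 2 / K ^+ 2.
have rho0 : 0 <= rho.
  rewrite subr_ge0 ler_pdivrMr ?exprn_gt0// mul1r ler_pXn2r ?nnegrE ?ltW//.
  by rewrite /K ltrDl.
have rho1 : rho < 1 by rewrite ltrBlDr ltrDl divr_gt0 ?exprn_gt0.
have GE x y : `|G x - G y| <= Num.sqrt rho * `|x - y|.
  have -> : G x - G y = (x - y) - s *: (t *: (x - y) + (B x - B y)).
    rewrite /G opprD opprK addrACA; congr (_ + _).
    rewrite addrC -opprB -scalerBr; congr (- (_ *: _)).
    by rewrite opprD addrACA -scalerBr.
  have := B_mon x y; have := lipschitz_norm x y.
  move: (x - y) (B x - B y) => e f lip mon.
  rewrite -(@ler_pXn2r _ 2) ?nnegrE ?mulr_ge0 ?sqrtr_ge0//.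
  rewrite exprMn sqr_sqrtr// -dot_norm.
  have h1 : `|t *: e + f| <= K * `|e|.
    rewrite (le_trans (ler_normD _ _))// normrZ gtr0_norm// /K mulrDl lerD2l//.
  have h2 : s ^+ 2 * dot (t *: e + f) (t *: e + f) <= s ^+ 2 * (K ^+ 2 * `|e| ^+ 2).
    rewrite ler_wpM2l ?sqr_ge0// dot_norm -exprMn ler_pXn2r ?nnegrE ?mulr_ge0 ?(ltW K0)//.
  have h3 : 0 <= s * dot e f by rewrite mulr_ge0 ?(ltW s0).
  have -> : rho * `|e| ^+ 2 = `|e| ^+ 2 - 2 * s * t * `|e| ^+ 2
      + s ^+ 2 * (K ^+ 2 * `|e| ^+ 2).
    by rewrite /rho /s; field; rewrite gt_eqF.
  apply: le_trans (lerD (lexx _) h2).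
  have : dot e (t *: e + f) = t * dot e e + dot e f by rewrite !(dotE dot).
  move: (t *: e + f) => g eg.
  rewrite -dot_norm !(dotE dot) (dotC dot g e) eg; lra.
pose F q := resolvent A s (G q).
have funF : isFun H H setT setT F by split.
pose Ff : {fun [set: H] >-> [set: H]} := HB.pack F funF.
have ctr : is_contraction Ff.
  exists (NngNum (sqrtr_ge0 rho)); split => /=.
    by rewrite -sqrtr1 ltr_sqrt.
  move=> [x y] _ /=; apply: le_trans (GE x y); exact: resolvent_nonexpansive.
have [||q _ qE] := banach_fixed_point ctr; [exact: closedT|by exists 0|].
exists q; have [u Au uE] := resolvent_spec dot_norm (G q) A_maxmon s0.
rewrite [resolvent A s (G q)](esym qE) in Au uE.
suff <- : u = - (t *: q) - B q by [].
move: uE; rewrite /G => /addrI; rewrite -scalerN => /scalerI -> //; last by rewrite gt_eqF.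
by rewrite opprD.
Qed.

Lemma zeros_graph x : zeros A B x -> A x (- B x).
Proof. by move=> [u Axu /eqP]; rewrite addr_eq0 => /eqP <-. Qed.

Lemma sum_monotone x y u v : A x (u - B x) -> A y (v - B y) ->
  0 <= dot (x - y) (u - v).
Proof.
move=> /(A_maxmon.1) + Ay => /(_ _ _ Ay); have := B_mon x y.
rewrite !(dotE dot); lra.
Qed.

Lemma tikhonov_path : zeros A B !=set0 ->
  exists (q : nat -> H) (p : H),
  [/\ forall k, A (q k) (- (harmonic k *: q k) - B (q k)),
      q k @[k --> \oo] --> p, zeros A B p &
      forall z, zeros A B z -> dot p p <= dot p z].
Proof.
move=> [z0 Oz0].
have [q qP] := choice (fun k => regularized_solution (@harmonic_gt0 R k)).
have q_le k z : zeros A B z -> dot (q k) (q k) <= dot (q k) z.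
  move=> /zeros_graph Az; have tk := @harmonic_gt0 R k.
  have := @sum_monotone _ _ _ 0 (qP k); rewrite -{1}[- B z]add0r in Az.
  move=> /(_ _ Az); rewrite subr0 (dotNr dot) (dotZr dot) -mulrN pmulr_rge0//.
  rewrite !(dotE dot) (dotC dot z); lra.
have q_bound k : dot (q k) (q k) <= `|z0| ^+ 2.
  have := q_le k _ Oz0; have := dot_ge0 dot_norm (q k - z0).
  rewrite -dot_norm !(dotE dot) (dotC dot z0); lra.
(* Monotonicity between two path points rearranges to [(ti + tj) * D <= (ti - tj) * (dot (q j) (q j)
   - dot (q i) (q i))]. So squared norms grow along the path, and their increments control squared
   distances. *)
have q_mono i j : (i < j)%N ->
    dot (q i - q j) (q i - q j) <= dot (q j) (q j) - dot (q i) (q i).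
  move=> ij; have := sum_monotone (qP i) (qP j).
  have ti := @harmonic_gt0 R i; have tj := @harmonic_gt0 R j.
  have tij : harmonic j < harmonic i :> R.
    by rewrite /harmonic ltf_pV2 ?posrE// ltr_nat ltnS.
  have := dot_ge0 dot_norm (q i - q j); set D := dot (q i - q j) (q i - q j).
  move: ti tj tij; set ti := harmonic i; set tj := harmonic j => ti0 tj0 tij D0 h.
  have {}h : (ti + tj) * D <= (ti - tj) * (dot (q j) (q j) - dot (q i) (q i)).
    move: h; rewrite /D !(dotE dot) (dotC dot (q j)); lra.
  have h0 : 0 <= dot (q j) (q j) - dot (q i) (q i).
    rewrite -(@pmulr_rge0 _ (ti - tj)) ?subr_gt0//.
    by apply: le_trans h; rewrite mulr_ge0 ?addr_ge0 ?(ltW ti0) ?(ltW tj0).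
  rewrite -(@ler_pM2l _ (ti + tj)) ?addr_gt0// (le_trans h)// ler_wpM2r//; lra.
have a_homo : {homo (fun n => dot (q n) (q n)) : i j / (i <= j)%N >-> i <= j}.
  move=> i j; rewrite leq_eqVlt => /predU1P[->//|/q_mono].
  have := dot_ge0 dot_norm (q i - q j) => /=; lra.
have a_cvg : cvgn (fun k => dot (q k) (q k)).
  apply: nondecreasing_is_cvgn => //; by exists (`|z0| ^+ 2) => _ [k _ <-]; exact: q_bound.
have a_le := nondecreasing_cvgn_le a_homo a_cvg.
set l := limn _ in a_le.
have /cvg_ex[/= p qp] : cvgn q.
  apply: (@sqdist_cvgn _ _ _ (fun k => l - dot (q k) (q k))).
    by rewrite -(subrr l); apply: cvgB => //; exact: cvg_cst.
  move=> i j; rewrite -dot_norm; have hi := a_le i; have hj := a_le j.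
  have [ij|ji|->] := ltngtP i j.
  - by have := q_mono _ _ ij; move: hi hj => /=; lra.
  - have := q_mono _ _ ji; rewrite -[q i - q j]opprB (dotNl dot) (dotNr dot).
    by move: hi hj => /=; lra.
  - by rewrite subrr (dot0l dot); move: hj => /=; lra.
exists q, p; split => //.
  exists (- B p); last by rewrite addNr.
  apply: (maximal_monotone_closed A_maxmon qP) => //.
  rewrite -[- B p]add0r; apply: cvgD.
    rewrite -oppr0 -(scale0r p); apply: cvgN; apply: cvgZ => //; exact: cvg_harmonic.
  apply: cvgN; apply/subr_cvg0/norm_cvg0P.
  apply: (@squeeze_cvgr _ _ _ _ (fun=> 0) (fun n => L * `|q n - p|)).
  - by apply: nearW => n; rewrite normr_ge0 lipschitz_norm.
  - exact: cvg_cst.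
  - by rewrite -(mulr0 L); apply: cvgMl_tmp; apply/norm_cvg0P/subr_cvg0.
move=> z Oz.
apply: (@ler_cvg_to _ (nbhs \oo) _ _ (fun k => dot (q k) (q k)) (fun k => dot (q k) z)).
- exact: (cvg_dot dot_norm).
- by apply: (cvg_dot dot_norm) => //; exact: cvg_cst.
- by apply: nearW => k; exact: q_le.
Qed.

(** The variational inequality yields [|z - p|^2 <= |z|^2 - |p|^2] on the zeros, which gives both
    minimality and uniqueness. *)
Lemma nearest_points_zeros p : zeros A B p ->
  (forall z, zeros A B z -> dot p p <= dot p z) ->
  nearest_points (zeros A B) 0 = [set p].
Proof.
move=> Op pP.
have dist z : zeros A B z -> `|z - p| ^+ 2 <= `|z| ^+ 2 - `|p| ^+ 2.
  move=> /pP; rewrite -!dot_norm !(dotE dot) (dotC dot z); lra.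
apply/seteqP; split => [z [Oz zmin]|_ ->] /=.
  have := zmin _ Op; rewrite !sub0r !normrN => zp.
  apply/eqP; rewrite -subr_eq0 -normr_eq0 -sqrf_eq0 eq_le sqr_ge0 andbT.
  by apply: le_trans (dist _ Oz) _; rewrite subr_le0 ler_pXn2r ?nnegrE.
split=> // z Oz; rewrite !sub0r !normrN -(@ler_pXn2r _ 2) ?nnegrE// -subr_ge0.
by apply: le_trans (dist _ Oz); rewrite sqr_ge0.
Qed.

(* Plays the role of weak sequential compactness: it bounds the limsup of
   [dot p (p - y)] along bounded approximate zeros [y], by comparing [p] with
   a point of the Tikhonov path close to it. *)
Lemma zeros_min_norm : zeros A B !=set0 ->
  exists p, [/\ zeros A B p, forall z, zeros A B z -> dot p p <= dot p z &
    forall K rho : R, 0 < rho -> exists2 delta : R, 0 < delta &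
      forall y r, A y (r - B y) -> `|y - p| <= K -> `|r| <= delta ->
        dot p (p - y) <= rho].
Proof.
move=> /tikhonov_path[q [p [qP qp Op pmin]]]; exists p; split=> // K rho rho0.
(* Replacing [p] by a path point within [eta] costs at most [rho / 2]. The absolute value of [K]
   appears because its sign is known only once some [y] is given. *)
pose eta := Num.min 1 (rho / (2 * (`|K| + `|p| + 1))).
have C0 : 0 < 2 * (`|K| + `|p| + 1) by rewrite mulr_gt0// ltr_wpDl ?addr_ge0.
have eta0 : 0 < eta by rewrite lt_min ltr01 divr_gt0.
have eta1 : eta <= 1 by rewrite ge_min lexx.
have eta_rho : eta * (`|K| + `|p| + 1) <= rho / 2.
  have : eta <= rho / (2 * (`|K| + `|p| + 1)) by rewrite ge_min lexx orbT.
  rewrite ler_pdivlMr//; lra.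
have /cvgrPdist_lt/(_ _ eta0)[k _ /(_ k (leqnn k)) /= pq] := qp.
have t0 := @harmonic_gt0 R k; set t := harmonic k in t0.
(* Monotonicity gives [t * dot (q k) (q k - y) <= |q k - y| * |r|] with [|q k - y| <= K + 1]; this
   [delta] makes the inner product at most [rho / 2]. *)
exists (t * (rho / (2 * (`|K| + 1)))).
  by rewrite mulr_gt0// divr_gt0// mulr_gt0// ltr_wpDl.
move=> y r Ayr yK rdelta.
have K0 : 0 <= K := le_trans (normr_ge0 _) yK.
rewrite (ger0_norm K0) in eta_rho rdelta.
have qy : `|q k - y| <= K + 1.
  have -> : q k - y = (p - y) - (p - q k) by rewrite opprB [RHS]addrC addrA subrK.
  apply: le_trans (ler_normB _ _) _; rewrite lerD//; first by rewrite distrC.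
  exact: le_trans (ltW pq) eta1.
have qn : `|q k| <= `|p| + 1.
  rewrite -{1}(subKr p (q k)).
  apply: le_trans (ler_normB _ _) _; rewrite lerD//.
  exact: le_trans (ltW pq) eta1.
have h1 : dot (q k) (q k - y) <= rho / 2.
  have := sum_monotone (qP k) Ayr; rewrite -/t => h.
  have := ler_norm (- dot (q k - y) r); rewrite normrN => h'.
  have := dot_CauchySchwarz dot_norm (q k - y) r => h''.
  have h3 : `|q k - y| * `|r| <= (K + 1) * (t * (rho / (2 * (K + 1)))).
    by apply: ler_pM.
  rewrite -(ler_pM2l t0).
  have e : (K + 1) * (t * (rho / (2 * (K + 1)))) = t * (rho / 2).
    by field; rewrite gt_eqF// ltr_wpDl.
  rewrite e in h3; apply: le_trans h3; apply: le_trans h''; apply: le_trans h'.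
  move: h; rewrite !(dotE dot) (dotC dot y (q k)); lra.
have h2 : dot (p - q k) (p - y) + dot (q k) (p - q k) <= rho / 2.
  apply: le_trans eta_rho.
  rewrite -addrA mulrDr lerD//.
    apply: le_trans (ler_norm _) _; apply: le_trans (dot_CauchySchwarz dot_norm _ _) _.
    by rewrite ler_pM// ?(ltW pq)// distrC.
  apply: le_trans (ler_norm _) _; apply: le_trans (dot_CauchySchwarz dot_norm _ _) _.
  by rewrite mulrC ler_pM// ltW.
have -> : dot p (p - y) = dot (q k) (q k - y) + (dot (p - q k) (p - y) + dot (q k) (p - q k)).
  rewrite !(dotE dot); lra.
lra.
Qed.

End Regularization.

(** * Nonnegative series and an averaging recursion *)

Section Series.
Variable R : realType.
Implicit Types (u v alpha : nat -> R).

Lemma nneseries_bounded u : (forall n, (1 <= n)%N -> 0 <= u n) ->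
  (\sum_(1 <= n <oo) (u n)%:E < +oo)%E ->
  exists M, forall n, \sum_(1 <= k < n) u k <= M.
Proof.
move=> u0 ulty; have ge n : ((\sum_(1 <= k < n) u k)%:E <= \sum_(1 <= n <oo) (u n)%:E)%E.
  rewrite -sumEFin; apply: nneseries_lim_ge => k k1 _; rewrite lee_fin; exact: u0.
have fin : (\sum_(1 <= n <oo) (u n)%:E)%E \is a fin_num.
  by rewrite ge0_fin_numE//; have := ge 0; rewrite big_geq.
by exists (fine (\sum_(1 <= n <oo) (u n)%:E)%E) => n; rewrite -lee_fin fineK.
Qed.

Lemma summable_cvg0 u : (forall n, (1 <= n)%N -> 0 <= u n) ->
  (\sum_(1 <= n <oo) (u n)%:E < +oo)%E -> u n @[n --> \oo] --> (0 : R).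
Proof.
move=> u0 /(nneseries_bounded u0)[M uM].
rewrite -cvg_shiftS; apply: cvg_series_cvg_0; apply: nondecreasing_is_cvgn.
  by apply/nondecreasing_series => n _ _; exact: u0.
exists M => _ [n _ <-]; apply: le_trans (uM n.+1).
by rewrite /series/= big_add1.
Qed.

Lemma nneseries_pinfty_unbounded u : (forall n, (1 <= n)%N -> 0 <= u n) ->
  (\sum_(1 <= n <oo) (u n)%:E = +oo)%E ->
  forall M, exists n, M < \sum_(1 <= k < n) u k.
Proof.
move=> u0 uoo M; apply: contrapT => nM.
have : (\sum_(1 <= n <oo) (u n)%:E <= M%:E)%E.
  apply: lime_le; first by apply: is_cvg_nneseries => n n1 _; rewrite lee_fin u0.
  apply: nearW => n; rewrite sumEFin lee_fin leNgt; apply/negP => lt.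
  by apply: nM; exists n.
by rewrite uoo.
Qed.

(* While [v n > 2 e] each step decreases [v] by at least [alpha n * e], which
   cannot go on forever; and [v n <= 2 e] is preserved. *)
Lemma averaging_eventually_le alpha v (e : R) N : 0 < e -> (1 <= N)%N ->
  (forall n, (1 <= n)%N -> 0 < alpha n < 1) ->
  (\sum_(1 <= n <oo) (alpha n)%:E = +oo)%E ->
  (forall n, 0 <= v n) ->
  (forall n, (N <= n)%N -> v n.+1 <= (1 - alpha n) * v n + alpha n * e) ->
  exists n0, forall n, (n0 <= n)%N -> v n <= 2 * e.
Proof.
move=> e0 N1 a01 aoo v0 vE.
have keep n0 : (N <= n0)%N -> v n0 <= 2 * e -> forall n, (n0 <= n)%N -> v n <= 2 * e.
  move=> Nn0 vn0 n /subnK <-; elim: (n - n0)%N => [//|m IH].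
  have Nm : (N <= m + n0)%N by rewrite (leq_trans Nn0)// leq_addl.
  have /andP[ap a1] := a01 _ (leq_trans N1 Nm).
  have h : (1 - alpha (m + n0)%N) * v (m + n0)%N <= (1 - alpha (m + n0)%N) * (2 * e).
    by rewrite ler_wpM2l// subr_ge0 ltW.
  have h' : 0 < alpha (m + n0)%N * e by rewrite mulr_gt0.
  have := vE _ Nm; rewrite addSn; lra.
have [[n0 [Nn0 vn0]]|all] := pselect (exists n0, (N <= n0)%N /\ v n0 <= 2 * e).
  by exists n0; exact: keep.
have big n : (N <= n)%N -> 2 * e < v n.
  by move=> Nn; rewrite ltNge; apply/negP => vn; apply: all; exists n.
have dec n : (N <= n)%N -> v n + e * \sum_(1 <= k < n) alpha k <=
    v N + e * \sum_(1 <= k < N) alpha k.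
  move=> /subnK <-; elim: (n - N)%N => [//|m IH].
  have Nm : (N <= m + N)%N by rewrite leq_addl.
  apply: le_trans IH; rewrite addSn big_nat_recr ?(leq_trans N1)//=.
  have /andP[ap a1] := a01 _ (leq_trans N1 Nm).
  have := vE _ Nm; have : alpha (m + N)%N * (2 * e) <= alpha (m + N)%N * v (m + N)%N.
    by rewrite ler_wpM2l ?(ltW ap)// ltW// big.
  lra.
have a0 n : (1 <= n)%N -> 0 <= alpha n by move=> /a01/andP[/ltW].
have [n] := nneseries_pinfty_unbounded a0 aoo ((v N + e * \sum_(1 <= k < N) alpha k) / e).
rewrite ltr_pdivrMr// => lt; exfalso.
have mono : \sum_(1 <= k < n) alpha k <= \sum_(1 <= k < n + N) alpha k.
  have [n1|n0] := leqP 1 n; last first.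
    by rewrite big_geq ?(ltnW n0)// big_nat sumr_ge0// => k /andP[k1 _]; exact: a0.
  rewrite (big_cat_nat (n := n) (p := n + N))//= ?leq_addr//.
  by rewrite lerDl big_nat sumr_ge0// => k /andP[k1 _]; apply: a0; exact: leq_trans k1.
have := dec _ (leq_addl n N); have := v0 (n + N)%N.
have : e * \sum_(1 <= k < n) alpha k <= e * \sum_(1 <= k < n + N) alpha k.
  by rewrite ler_wpM2l// ltW.
lra.
Qed.

End Series.

(** * The adaptive step size *)

Section Stepsize.
Variables (R : realType) (H : completeNormedModType R).
Variables (B : H -> H) (L mu : R).
Hypotheses (L_gt0 : 0 < L) (B_lip : L.-lipschitz B) (mu01 : 0 < mu < 1).
Implicit Types (lam xi : R) (w y : H).

Let mu_gt0 : 0 < mu. Proof. by case/andP: mu01. Qed.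

Lemma next_stepsize_ge lam xi w y : 0 <= xi ->
  Num.min (mu / L) lam <= next_stepsize B mu lam xi w y.
Proof.
move=> xi0; rewrite /next_stepsize; case: eqVneq => [_|Bwy].
  by rewrite ge_min lerDl xi0 orbT.
have D0 : 0 < `|B w - B y| by rewrite normr_gt0 subr_eq0.
rewrite le_min !ge_min lerDl xi0 orbT andbT ler_pdivlMr//; apply/orP; left.
by rewrite -mulrA ler_pM2l// ler_pdivrMl// (lipschitz_norm B_lip).
Qed.

Lemma next_stepsize_le lam xi w y : next_stepsize B mu lam xi w y <= lam + xi.
Proof. by rewrite /next_stepsize; case: ifP => // _; rewrite ge_min lexx orbT. Qed.

(** The bound holds for the updated step size, whereas the iteration needs it for the current one;
    [stepsize_contraction] closes this gap. *)
Lemma next_stepsize_norm lam xi w y :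
  next_stepsize B mu lam xi w y * `|B w - B y| <= mu * `|w - y|.
Proof.
rewrite /next_stepsize; case: eqVneq => [->|Bwy].
  by rewrite subrr normr0 mulr0 mulr_ge0// ltW.
have D0 : 0 < `|B w - B y| by rewrite normr_gt0 subr_eq0.
by rewrite -ler_pdivlMr// ge_min lexx.
Qed.

(* [lambda n - \sum_(k < n) xi k] is nonincreasing and bounded below, so the
   decrements of [lambda] vanish in the limit. *)
Lemma stepsize_contraction (xi lambda : nat -> R) (w y : nat -> H) :
  (forall n, (1 <= n)%N -> 0 <= xi n) ->
  (\sum_(1 <= n <oo) (xi n)%:E < +oo)%E -> 0 < lambda 1%N ->
  (forall n, (1 <= n)%N ->
     lambda n.+1 = next_stepsize B mu (lambda n) (xi n) (w n) (y n)) ->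
  exists (lmin kappa : R) N, [/\ 0 < lmin, 0 <= kappa < 1, (1 <= N)%N,
    forall n, (1 <= n)%N -> lmin <= lambda n &
    forall n, (N <= n)%N ->
      lambda n * `|B (w n) - B (y n)| <= kappa * `|w n - y n|].
Proof.
move=> xi0 xi_sum l1 lE; pose lmin := Num.min (mu / L) (lambda 1%N).
have lmin0 : 0 < lmin by rewrite lt_min l1 divr_gt0.
have l_ge n : (1 <= n)%N -> lmin <= lambda n.
  elim: n => // n IH _; have [->|n0] := posnP n; first by rewrite ge_min lexx orbT.
  rewrite lE//; apply: le_trans (next_stepsize_ge _ _ _ (xi0 _ n0)).
  by rewrite le_min ge_min lexx IH.
have [M xiM] := nneseries_bounded xi0 xi_sum.
pose s n := \sum_(1 <= k < n.+1) xi k - lambda n.+1.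
have s_step n : s n.+1 - s n = xi n.+1 + lambda n.+1 - lambda n.+2.
  by rewrite /s big_nat_recr//=; ring.
have s_cvg : cvgn s.
  apply: nondecreasing_is_cvgn.
    apply/nondecreasing_seqP => n; rewrite -subr_ge0 s_step [lambda n.+2]lE// subr_ge0 addrC.
    exact: next_stepsize_le.
  exists M => _ [n _ <-]; rewrite /s lerBlDr (le_trans (xiM _))// lerDl.
  by rewrite ltW// (lt_le_trans lmin0)// l_ge.
have ds : (s n.+1 - s n) @[n --> \oo] --> (0 : R).
  rewrite -(subrr (limn s)); apply: cvgB => //.
  by rewrite (cvg_shiftS s).
have [mu0 mu1] := andP mu01.
have r0 : 0 < (1 - mu) / 2 * lmin by rewrite mulr_gt0// divr_gt0// subr_gt0.
have /cvgrPdist_lt/(_ _ r0)[N _ sN] := ds.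
(* [kappa] is the midpoint of [mu] and 1. A drop of [lambda] below [(1 - mu) / 2 * lmin] gives
   [mu * lambda n <= kappa * lambda n.+1]. *)
exists lmin, ((1 + mu) / 2), N.+1; split => //; first by apply/andP; split; lra.
case=> // n Nn.
have /= := sN n Nn; rewrite sub0r normrN s_step => /ltW/(le_trans (ler_norm _)) dl.
have D0 := normr_ge0 (B (w n.+1) - B (y n.+1)).
have := next_stepsize_norm (lambda n.+1) (xi n.+1) (w n.+1) (y n.+1).
rewrite -(lE n.+1)// => hmu.
have ln2 : lmin <= lambda n.+2 by rewrite l_ge.
have xn := xi0 n.+1 isT.
have l12 : mu * lambda n.+1 <= (1 + mu) / 2 * lambda n.+2.
  have m1 : mu * (lambda n.+1 - lambda n.+2) <= mu * ((1 - mu) / 2 * lmin).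
    by rewrite ler_wpM2l// ?(ltW mu_gt0)//; lra.
  have m2 : mu * ((1 - mu) / 2 * lmin) <= (1 - mu) / 2 * lambda n.+2.
    apply: (@le_trans _ _ ((1 - mu) / 2 * lmin)).
      by rewrite ler_piMl ?(ltW r0)// ltW.
    by rewrite ler_wpM2l//; lra.
  lra.
rewrite -(ler_pM2l mu_gt0) mulrA.
apply: (@le_trans _ _ ((1 + mu) / 2 * lambda n.+2 * `|B (w n.+1) - B (y n.+1)|)).
  by rewrite ler_wpM2r.
rewrite -mulrA mulrCA; rewrite mulrCA [leRHS]mulrCA.
by rewrite ler_wpM2l//; lra.
Qed.

End Stepsize.

(** * One projection-contraction step *)

Section Step.
Variables (R : realType) (H : completeNormedModType R).
Variable dot : {dot H for idfun}.
Hypothesis dot_norm : forall x : H, dot x x = `|x| ^+ 2.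
Variables (A : H -> set H) (B : H -> H).
Hypothesis A_maxmon : maximal_monotone dot A.
Hypothesis B_mon : monotone_map dot B.
Implicit Types (p w x y z u d : H).

Lemma inertial_step (bar e : R) x x' :
  0 <= bar -> 0 <= e ->
  `|inertial_weight bar e x x' *: (x - x')| <= e.
Proof.
move=> bar0 e0; rewrite /inertial_weight; case: eqVneq => [->|xx'].
  by rewrite subrr scaler0 normr0.
have D0 : 0 < `|x - x'| by rewrite normr_gt0 subr_eq0.
rewrite normrZ ger0_norm; last by rewrite !le_min bar0 !divr_ge0// ?exprn_ge0.
by rewrite -ler_pdivlMr// !ge_min lexx orbT.
Qed.

(** Convexity of the squared norm with weights of sum [s + t], followed by
    [|v - a p|^2 <= |v|^2 - 2 a <p, v - a p>]. *)
Lemma combination_sqr_norm (s t a : R) (P Q p : H) : 0 <= s -> 0 <= t ->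
  `|s *: P + t *: Q - a *: p| ^+ 2 <=
    (s + t) * (s * `|P| ^+ 2 + t * `|Q| ^+ 2)
    - 2 * a * dot p (s *: P + t *: Q - a *: p).
Proof.
move=> s0 t0.
have h1 : 0 <= s * t * dot (P - Q) (P - Q).
  by rewrite mulr_ge0 ?mulr_ge0 ?dot_ge0.
have h2 := dot_ge0 dot_norm (a *: p).
move: h1 h2; rewrite -!dot_norm !(dotE dot).
rewrite (dotC dot Q P) (dotC dot p P) (dotC dot p Q); lra.
Qed.

Variables (gamma kappa lam : R) (w y d u : H).
Hypotheses (gamma02 : 0 < gamma < 2) (kappa01 : 0 <= kappa < 1) (lam_gt0 : 0 < lam).
Hypothesis contr : lam * `|B w - B y| <= kappa * `|w - y|.
Hypothesis yE : y = resolvent A lam (w - lam *: B w).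
Hypothesis yw : y <> w.
Hypothesis dE : d = w - y - lam *: (B w - B y).
Hypothesis uE : u = w - (gamma * descent_coef dot w y d) *: d.

Let e_gt0 : 0 < `|w - y|.
Proof. by rewrite normr_gt0 subr_eq0; apply/eqP => wy; exact/yw/esym. Qed.

(** Makes [y] an approximate zero of [A + B], with residual [lam^-1 *: d] controlled by [w - y]. *)
Lemma residual_graph : A y (lam^-1 *: d - B y).
Proof.
have [v Av vE] := resolvent_spec dot_norm (w - lam *: B w) A_maxmon lam_gt0.
rewrite -yE in Av vE.
suff <- : v = lam^-1 *: d - B y by [].
apply: (@scalerI _ _ lam); first by rewrite gt_eqF.
have -> : lam *: v = w - lam *: B w - y by rewrite -vE addrC addKr.
rewrite scalerBr scalerA divff ?gt_eqF// scale1r dE scalerBr opprB addrA.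
by rewrite [RHS]addrAC addrK addrAC.
Qed.

Lemma descent_norm : `|d| <= 2 * `|w - y|.
Proof.
case/andP: kappa01 => k0 k1.
rewrite dE (le_trans (ler_normB _ _))// normrZ gtr0_norm//.
have : kappa * `|w - y| <= `|w - y| by rewrite ler_piMl// ltW.
move: contr; lra.
Qed.

Lemma dot_descent : (1 - kappa) * `|w - y| ^+ 2 <= dot (w - y) d.
Proof.
have := dot_CauchySchwarz dot_norm (w - y) (lam *: (B w - B y)).
rewrite normrZ (gtr0_norm lam_gt0) => h.
have h1 : `|w - y| * (lam * `|B w - B y|) <= `|w - y| * (kappa * `|w - y|).
  by rewrite ler_wpM2l.
have h2 := ler_norm (dot (w - y) (lam *: (B w - B y))).
rewrite dE (dotDr dot) (dotNr dot) dot_norm; lra.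
Qed.

(** Excludes the default branch of [descent_coef]. *)
Let d_neq0 : d != 0.
Proof.
apply: contraTneq dot_descent => ->; rewrite (dot0r dot) -ltNge.
by case/andP: kappa01 => _ k1; rewrite mulr_gt0 ?subr_gt0 ?exprn_gt0.
Qed.

Lemma relaxed_step_norm : `|u - w| <= 2 * `|w - y|.
Proof.
case/andP: gamma02 => g0 g2.
rewrite uE addrAC subrr sub0r normrN normrZ normrM gtr0_norm// /descent_coef (negbTE d_neq0).
have n0 : 0 < `|d| by rewrite normr_gt0.
rewrite normrM normfV (ger0_norm (sqr_ge0 `|d|)).
rewrite -mulrA; apply: ler_pM; rewrite ?(ltW g0) ?(ltW g2)//.
have -> : `|dot (w - y) d| / `|d| ^+ 2 * `|d| = `|dot (w - y) d| / `|d|.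
  by field; rewrite gt_eqF.
by rewrite ler_pdivrMr// dot_CauchySchwarz.
Qed.

(** [u] is a relaxed projection of [w] onto the half-space of [v] with [dot (y - v) d >= 0], which
    contains every zero by monotonicity. The gain is [gamma * (2 - gamma) * c ^+ 2 / D]. *)
Lemma relaxed_step_descent p : zeros A B p ->
  `|u - p| ^+ 2 <= `|w - p| ^+ 2
    - gamma * (2 - gamma) * ((1 - kappa) / 2) ^+ 2 * `|w - y| ^+ 2.
Proof.
move=> /zeros_graph Ap; case/andP: gamma02 => g0 g2; case/andP: kappa01 => k0 k1.
have yp : 0 <= dot (y - p) d.
  have := sum_monotone A_maxmon B_mon residual_graph (v := 0) (y := p).
  rewrite sub0r => /(_ Ap); rewrite subr0 (dotZr dot) pmulr_rge0// invr_gt0//.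
have n0 : 0 < `|d| by rewrite normr_gt0.
rewrite uE /descent_coef (negbTE d_neq0).
set c := dot (w - y) d; set D := `|d| ^+ 2.
have D0 : 0 < D by rewrite exprn_gt0.
have c_ge : (1 - kappa) * `|w - y| ^+ 2 <= c := dot_descent.
have c0 : 0 <= c by apply: le_trans c_ge; rewrite mulr_ge0 ?sqr_ge0// subr_ge0 ltW.
have wp : c <= dot (w - p) d.
  move: yp; rewrite /c !(dotE dot); lra.
have key : ((1 - kappa) / 2) ^+ 2 * `|w - y| ^+ 2 <= c ^+ 2 / D.
  rewrite ler_pdivlMr//.
  have h1 : D <= 4 * `|w - y| ^+ 2.
    have -> : 4 * `|w - y| ^+ 2 = (2 * `|w - y|) ^+ 2 by ring.
    by rewrite ler_pXn2r ?nnegrE ?mulr_ge0// descent_norm.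
  apply: (@le_trans _ _ (((1 - kappa) / 2) ^+ 2 * `|w - y| ^+ 2 * (4 * `|w - y| ^+ 2))).
    by rewrite ler_wpM2l// mulr_ge0 ?sqr_ge0.
  have -> : ((1 - kappa) / 2) ^+ 2 * `|w - y| ^+ 2 * (4 * `|w - y| ^+ 2) =
     ((1 - kappa) * `|w - y| ^+ 2) ^+ 2 by field.
  by rewrite ler_pXn2r ?nnegrE// mulr_ge0 ?sqr_ge0// subr_ge0 ltW.
have -> : w - (gamma * (c / D)) *: d - p = (w - p) - (gamma * (c / D)) *: d by rewrite addrAC.
have exp1 : `|(w - p) - (gamma * (c / D)) *: d| ^+ 2 =
   `|w - p| ^+ 2 - 2 * (gamma * (c / D)) * dot (w - p) d + gamma ^+ 2 * (c ^+ 2 / D).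
  rewrite -!dot_norm; move: wp; move: (w - p) => f _.
  rewrite !(dotE dot) (dotC dot d f) (dot_norm d) -/D; field; rewrite gt_eqF//.
have m1 : gamma * (c / D) * c <= gamma * (c / D) * dot (w - p) d.
  by rewrite ler_wpM2l// mulr_ge0 ?divr_ge0// ltW.
have m2 : gamma * (c / D) * c = gamma * (c ^+ 2 / D) by field; rewrite gt_eqF.
have m3 : gamma * (2 - gamma) * (((1 - kappa) / 2) ^+ 2 * `|w - y| ^+ 2) <=
   gamma * (2 - gamma) * (c ^+ 2 / D).
  by rewrite ler_wpM2l// mulr_ge0 ?(ltW g0)// subr_ge0 ltW.
rewrite exp1; lra.
Qed.

End Step.

(** * One averaged step with anchor 0 *)

Section HalpernStep.
Variables (R : realType) (H : completeNormedModType R).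
Variable dot : {dot H for idfun}.
Hypothesis dot_norm : forall x : H, dot x x = `|x| ^+ 2.
Variables (al sg e : R) (x z w u x' p : H).
Hypotheses (al_gt0 : 0 < al) (sg_gt0 : 0 < sg) (sg_lt : sg < 1 - al).
Hypotheses (zx : `|z - x| <= e) (wx : `|w - x| <= e).
Hypothesis x'E : x' = (1 - al - sg) *: z + sg *: u.

Let s_gt0 : 0 < 1 - al - sg. Proof. by rewrite subr_gt0. Qed.

Let e_ge0 : 0 <= e. Proof. exact: le_trans zx. Qed.

(** The weights of [z] and [u] sum to [1 - al]; the missing mass sits on the anchor 0 and produces
    [- al *: p]. *)
Let x'p : x' - p = (1 - al - sg) *: (z - p) + sg *: (u - p) - al *: p.
Proof.
rewrite x'E !scalerBr [in RHS]addrACA -[RHS]addrA; congr (_ + _).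
by rewrite -!opprD -!scalerDl subrK subrK scale1r.
Qed.

Let near_norm v : `|v - x| <= e -> `|v - p| <= `|x - p| + e.
Proof.
move=> vx; have -> : v - p = (x - p) + (v - x) by rewrite [RHS]addrC addrA subrK.
by rewrite (le_trans (ler_normD _ _))// lerD2l.
Qed.

Lemma halpern_step_norm : `|u - p| <= `|w - p| ->
  `|x' - p| <= (1 - al) * `|x - p| + e + al * `|p|.
Proof.
move=> /le_trans/(_ (near_norm wx)) hu; have hz := near_norm zx.
rewrite x'p (le_trans (ler_normB _ _))//.
rewrite (le_trans (lerD (ler_normD _ _) (lexx _)))// !normrZ !gtr0_norm//.
have h1 := ler_wpM2l (ltW s_gt0) hz; have h2 := ler_wpM2l (ltW sg_gt0) hu.
have : 0 <= al * e by rewrite mulr_ge0// ltW.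
lra.
Qed.

Lemma halpern_step_sqr_norm (g K M : R) : 0 <= g -> `|x - p| <= K -> e <= M ->
  `|u - p| ^+ 2 <= `|w - p| ^+ 2 - g ->
  `|x' - p| ^+ 2 <= (1 - al) * `|x - p| ^+ 2 + e * (2 * K + M)
    + 2 * al * dot p (p - x') - (1 - al) * sg * g.
Proof.
move=> g0 xK eM hu.
have sq v : `|v - x| <= e -> `|v - p| ^+ 2 <= `|x - p| ^+ 2 + e * (2 * K + M).
  move=> /near_norm vx; apply: (@le_trans _ _ ((`|x - p| + e) ^+ 2)).
    by rewrite ler_pXn2r ?nnegrE ?addr_ge0.
  have h2 := ler_wpM2l e_ge0 xK; have h3 := ler_wpM2l e_ge0 eM.
  rewrite sqrrD; lra.
have E0 : 0 <= e * (2 * K + M).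
  have K0 := le_trans (normr_ge0 _) xK; have M0 := le_trans e_ge0 eM.
  by rewrite mulr_ge0// addr_ge0// mulr_ge0.
have hz' := ler_wpM2l (ltW s_gt0) (sq _ zx).
have hu' := ler_wpM2l (ltW sg_gt0) (le_trans hu (lerD (sq _ wx) (lexx _))).
have := combination_sqr_norm dot_norm al (z - p) (u - p) p (ltW s_gt0) (ltW sg_gt0).
rewrite -x'p -[dot p (p - _)]opprK -(dotNr dot) opprB subrK.
move: (`|x - p| ^+ 2) (sqr_ge0 `|x - p|) (e * (2 * K + M)) E0 hz' hu' => X X0 E E0 hz' hu'.
have al1 : 0 <= 1 - al by move: sg_gt0 sg_lt; lra.
have h1 := ler_wpM2l al1 (lerD hz' hu').
(* The weights produce the factor [(1 - al) ^+ 2]; dropping this nonnegative term leaves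
   [1 - al]. *)
have h2 : 0 <= (1 - al) * al * (X + E).
  by apply: mulr_ge0; [exact: mulr_ge0 al1 (ltW al_gt0)|exact: addr_ge0].
have h4 : 0 <= al * E by rewrite mulr_ge0// ltW.
lra.
Qed.

(** Carries the estimate of [dot p (p - y)] at the approximate zero [y] over to the new iterate. *)
Lemma halpern_step_dist (y : H) : `|u - w| <= 2 * `|w - y| ->
  `|y - x'| <= 3 * `|w - y| + 2 * e + al * `|w|.
Proof.
move=> uw; have al1 : 0 < 1 - al := lt_trans sg_gt0 sg_lt.
have -> : y - x' = al *: w - (w - y)
    - ((1 - al - sg) *: (z - w) + sg *: (u - w)).
  have -> : (1 - al - sg) *: (z - w) + sg *: (u - w) = x' - (w - al *: w).
    rewrite x'E !scalerBr addrACA -opprD -scalerDl; congr (_ - _).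
    by rewrite subrK scalerBl scale1r.
  rewrite !opprB [RHS]addrA; congr (_ - _).
  by rewrite [RHS]addrAC [al *: w + _]addrC subrK addrC subrK.
have zw : `|z - w| <= 2 * e.
  have -> : z - w = (z - x) - (w - x) by rewrite opprB addrA subrK.
  rewrite (le_trans (ler_normB _ _))//; move: zx wx; lra.
rewrite (le_trans (ler_normB _ _))//.
rewrite (le_trans (lerD (ler_normB _ _) (ler_normD _ _)))// !normrZ !gtr0_norm//.
have h2 : (1 - al - sg) * `|z - w| <= 2 * e.
  by apply: le_trans zw; rewrite ler_piMl//; move: al_gt0 sg_gt0; lra.
have h3 : sg * `|u - w| <= 2 * `|w - y|.
  by apply: le_trans uw; rewrite ler_piMl//; move: al_gt0 sg_lt; lra.
lra.
Qed.

End HalpernStep.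

(** * Strong convergence of the averaged iteration *)

Section HalpernConvergence.
Variables (R : realType) (H : completeNormedModType R).
Variable dot : {dot H for idfun}.
Hypothesis dot_norm : forall x : H, dot x x = `|x| ^+ 2.
Variables (alpha sigma eps : nat -> R) (x z w u y : nat -> H) (p : H).
Variables (a c : R) (N : nat).
Hypothesis alpha01 : forall n, (1 <= n)%N -> 0 < alpha n < 1.
Hypothesis alpha_cvg0 : alpha n @[n --> \oo] --> (0 : R).
Hypothesis alpha_sum : (\sum_(1 <= n <oo) (alpha n)%:E = +oo)%E.
Hypothesis a_gt0 : 0 < a.
Hypothesis sigma_bnd : forall n, (1 <= n)%N -> a < sigma n < 1 - alpha n.
Hypothesis eps_ge0 : forall n, (1 <= n)%N -> 0 <= eps n.
Hypothesis eps_sum : (\sum_(1 <= n <oo) (eps n / alpha n)%:E < +oo)%E.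
Hypothesis zx : forall n, (1 <= n)%N -> `|z n - x n| <= eps n.
Hypothesis wx : forall n, (1 <= n)%N -> `|w n - x n| <= eps n.
Hypothesis xE : forall n, (1 <= n)%N ->
  x n.+1 = (1 - alpha n - sigma n) *: z n + sigma n *: u n.
Hypotheses (N_gt0 : (1 <= N)%N) (c_gt0 : 0 < c).
Hypothesis uw : forall n, (N <= n)%N -> `|u n - w n| <= 2 * `|w n - y n|.
Hypothesis descent : forall n, (N <= n)%N ->
  `|u n - p| ^+ 2 <= `|w n - p| ^+ 2 - c * `|w n - y n| ^+ 2.
Hypothesis p_var : forall K rho : R, 0 < rho -> exists2 delta : R, 0 < delta &
  forall n, (N <= n)%N -> `|y n - p| <= K -> `|w n - y n| <= delta ->
    dot p (p - y n) <= rho.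

Let leN n : (N <= n)%N -> (1 <= n)%N. Proof. exact: leq_trans. Qed.

Let al_gt0 n : (1 <= n)%N -> 0 < alpha n.
Proof. by move=> /alpha01/andP[]. Qed.

Let sg_gt n : (1 <= n)%N -> a < sigma n.
Proof. by move=> /sigma_bnd/andP[]. Qed.

Let sg_gt0 n : (1 <= n)%N -> 0 < sigma n.
Proof. by move=> /sg_gt; exact: lt_trans. Qed.

Let sg_lt n : (1 <= n)%N -> sigma n < 1 - alpha n.
Proof. by move=> /sigma_bnd/andP[]. Qed.

Let ratio_ge0 n : (1 <= n)%N -> 0 <= eps n / alpha n.
Proof. by move=> n1; rewrite divr_ge0 ?eps_ge0// ltW// al_gt0. Qed.

Let eps_le : exists2 M : R, 0 <= M & forall n, (1 <= n)%N -> eps n <= alpha n * M.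
Proof.
have [M ratio_sum] := nneseries_bounded ratio_ge0 eps_sum.
have ratio_le n : (1 <= n)%N -> eps n / alpha n <= M.
  move=> n1; apply: le_trans (ratio_sum n.+1); rewrite big_nat_recr//= lerDr.
  by rewrite big_nat sumr_ge0// => k /andP[k1 _]; exact: ratio_ge0.
exists M; first exact: le_trans (ratio_ge0 (leqnn 1)) (ratio_le 1%N isT).
by move=> n n1; rewrite mulrC -ler_pdivrMr ?al_gt0// ratio_le.
Qed.

(** Since [eps n <= alpha n * M], the next distance to [p] is at most a convex combination of the
    current one and [|p| + M]. *)
Lemma halpern_bounded :
  exists2 K : R, 0 <= K & forall n, (N <= n)%N -> `|x n - p| <= K.
Proof.
have [M M0 epsM] := eps_le.
exists (Num.max `|x N - p| (`|p| + M)); first by rewrite le_max normr_ge0.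
set K := Num.max _ _; move=> n /subnK <-.
elim: (n - N)%N => [|m IH]; first by rewrite le_max lexx.
rewrite addSn; have : (N <= m + N)%N by rewrite leq_addl.
move: (m + N)%N IH => {m} {}n IH Nn; have n1 := leN Nn.
have up : `|u n - p| <= `|w n - p|.
  rewrite -(@ler_pXn2r _ 2) ?nnegrE// (le_trans (descent Nn))// gerBl.
  by rewrite mulr_ge0 ?sqr_ge0// ltW.
have := halpern_step_norm (al_gt0 n1) (sg_gt0 n1) (sg_lt n1) (zx n1) (wx n1) (xE n1) up.
have h1 : (1 - alpha n) * `|x n - p| <= (1 - alpha n) * K.
  by rewrite ler_wpM2l// ltW// (lt_trans (sg_gt0 n1))// sg_lt.
have h2 : alpha n * (`|p| + M) <= alpha n * K.
  by rewrite ler_wpM2l ?(ltW (al_gt0 n1))// le_max lexx orbT.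
have := epsM n n1; move: h1 h2; lra.
Qed.

Lemma halpern_eventually (rho : R) : 0 < rho ->
  exists2 N', (1 <= N')%N & forall n, (N' <= n)%N ->
    `|x n.+1 - p| ^+ 2 <= (1 - alpha n) * `|x n - p| ^+ 2 + alpha n * rho.
Proof.
move=> rho0; have [K K0 xK] := halpern_bounded; have [M M0 epsM] := eps_le.
have epsM' n : (1 <= n)%N -> eps n <= M.
  move=> n1; apply: le_trans (epsM n n1) _; rewrite ler_piMl//.
  by have /andP[_ /ltW] := alpha01 n1.
have rho8 : 0 < rho / 8 by rewrite divr_gt0.
have [delta1 delta10 hvar] := p_var (K + M + 1) rho8.
have P0 : 0 < `|p| + 1 by rewrite ltr_wpDl.
pose C := `|p| + K + 3 * M + 1.
have C0 : 0 < C by rewrite ltr_wpDl// !addr_ge0// mulr_ge0.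
(* The bound 1 keeps [y n] within [K + M + 1] of [p]; the last bound leaves [rho / 16] for the
   [w n - y n] part of [px]. *)
pose delta := Num.min 1 (Num.min delta1 (rho / (48 * (`|p| + 1)))).
have delta0 : 0 < delta by rewrite !lt_min ltr01 delta10 divr_gt0 ?mulr_gt0.
have c20 : 0 < a ^+ 2 * c by rewrite mulr_gt0 ?exprn_gt0.
set c2 := a ^+ 2 * c in c20.
have pK0 : 0 < 2 * (`|p| * K) + 1 by rewrite ltr_wpDl ?mulr_ge0.
(* The first bound leaves [rho / 16] for the [alpha n * C] part of [px]; the second lets the descent
   term win when [|w n - y n|] is at least [delta]. *)
pose al := Num.min (rho / (16 * (`|p| + 1) * C)) (c2 * delta ^+ 2 / (2 * (`|p| * K) + 1)).
have al0 : 0 < al.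
  rewrite lt_min; apply/andP; split; apply: divr_gt0 => //; first by rewrite !mulr_gt0.
  exact: mulr_gt0 c20 (exprn_gt0 2 delta0).
have KM0 : 0 < 2 * K + M + 1 by rewrite ltr_wpDl ?addr_ge0 ?mulr_ge0.
have r0 : 0 < rho / 2 / (2 * K + M + 1) by rewrite !divr_gt0.
have /cvgrPdist_lt/(_ _ al0)[N1 _ hN1] := alpha_cvg0.
have /cvgrPdist_lt/(_ _ r0)[N2 _ hN2] := summable_cvg0 ratio_ge0 eps_sum.
exists (maxn N (maxn N1 N2)); first by rewrite leq_max N_gt0.
move=> n; rewrite !geq_max => /and3P[Nn /hN1 + /hN2].
rewrite /= !sub0r !normrN => /ltW/(le_trans (ler_norm _)) an.
have n1 := leN Nn; have an0 := al_gt0 n1.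
move=> /ltW/(le_trans (ler_norm _)); rewrite ler_pdivrMr// => en.
have {}en : eps n * (2 * K + M) <= alpha n * (rho / 2).
  apply: (@le_trans _ _ (eps n * (2 * K + M + 1))).
    by rewrite ler_wpM2l ?lerDl// eps_ge0.
  have := ler_wpM2r (ltW KM0) en.
  have -> // : rho / 2 / (2 * K + M + 1) * alpha n * (2 * K + M + 1) = alpha n * (rho / 2).
  by field; rewrite gt_eqF.
have al1 : alpha n <= rho / (16 * (`|p| + 1) * C) by rewrite (le_trans an)// ge_min lexx.
have al2 : alpha n <= c2 * delta ^+ 2 / (2 * (`|p| * K) + 1).
  by rewrite (le_trans an)// ge_min lexx orbT.
have e2 := sqr_ge0 `|w n - y n|.
have := halpern_step_sqr_norm dot_norm (al_gt0 n1) (sg_gt0 n1) (sg_lt n1) (zx n1)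
  (wx n1) (xE n1) (mulr_ge0 (ltW c_gt0) e2) (xK n Nn) (epsM' n n1) (descent Nn).
(* Since [a < sigma n < 1 - alpha n], the factor [(1 - alpha n) * sigma n] is at least [a ^+ 2]. *)
have main : c2 * `|w n - y n| ^+ 2 <= (1 - alpha n) * sigma n * (c * `|w n - y n| ^+ 2).
  rewrite /c2 -mulrA; apply: ler_wpM2r; first exact: mulr_ge0 (ltW c_gt0) e2.
  have := ltW (sg_gt n1); have := ltW (lt_trans (sg_gt n1) (sg_lt n1)).
  by rewrite expr2; apply: ler_pM; exact: ltW.
move=> /le_trans; apply.
(* The inertial errors have already taken the other half of [alpha n * rho]. *)
suff : 2 * alpha n * dot p (p - x n.+1) - c2 * `|w n - y n| ^+ 2 <= alpha n * (rho / 2).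
  lra.
have [big|small] := leP delta `|w n - y n|.
  have h1 : c2 * delta ^+ 2 <= c2 * `|w n - y n| ^+ 2.
    by rewrite ler_wpM2l ?(ltW c20)// ler_pXn2r ?nnegrE// ltW.
  have h2 : dot p (p - x n.+1) <= `|p| * K.
    apply: le_trans (ler_norm _) _; apply: le_trans (dot_CauchySchwarz dot_norm _ _) _.
    by rewrite ler_wpM2l// distrC xK// leqW.
  have h3 := ler_wpM2l (ltW an0) h2.
  have h4 : alpha n * (2 * (`|p| * K) + 1) <= c2 * delta ^+ 2 by rewrite -ler_pdivlMr.
  have h5 : 0 < alpha n * rho by rewrite mulr_gt0.
  lra.
move/ltW: small; rewrite !le_min => /and3P[d1 d2 d3].
have wK : `|w n - p| <= K + M.
  have -> : w n - p = (x n - p) + (w n - x n) by rewrite [RHS]addrC addrA subrK.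
  by rewrite (le_trans (ler_normD _ _))// lerD ?xK// (le_trans (wx n1))// epsM'.
have yp : dot p (p - y n) <= rho / 8.
  apply: (hvar _ Nn) => //.
  have -> : y n - p = (w n - p) - (w n - y n) by rewrite opprB [RHS]addrC addrA subrK.
  by rewrite (le_trans (ler_normB _ _))// lerD.
have xy : `|y n - x n.+1| <= 3 * `|w n - y n| + alpha n * C.
  have wn : `|w n| <= `|p| + K + M.
    have -> : w n = p + (w n - p) by rewrite addrC subrK.
    by rewrite (le_trans (ler_normD _ _))// -addrA lerD2l.
  have h1 := ler_wpM2l (ltW an0) wn; have h2 := epsM n n1.
  have := halpern_step_dist (al_gt0 n1) (sg_gt0 n1) (sg_lt n1) (zx n1) (wx n1) (xE n1) (uw Nn).
  rewrite /C; lra.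
have px : dot p (y n - x n.+1) <= rho / 8.
  apply: le_trans (ler_norm _) _; apply: le_trans (dot_CauchySchwarz dot_norm _ _) _.
  apply: (@le_trans _ _ ((`|p| + 1) * (3 * `|w n - y n| + alpha n * C))).
    by rewrite ler_pM// lerDl.
  move: d3 al1; rewrite !ler_pdivlMr ?mulr_gt0//; lra.
have -> : dot p (p - x n.+1) = dot p (p - y n) + dot p (y n - x n.+1).
  by rewrite -(dotDr dot) addrA subrK.
have h1 := ler_wpM2l (ltW an0) (lerD yp px).
have h2 : 0 <= c2 * `|w n - y n| ^+ 2 by rewrite mulr_ge0 ?(ltW c20).
lra.
Qed.

Lemma halpern_cvg : x n @[n --> \oo] --> p.
Proof.
apply/cvgrPdist_le => e e0.
have e20 : 0 < e ^+ 2 / 2 by rewrite divr_gt0 ?exprn_gt0.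
have [N' N'1 hN'] := halpern_eventually e20.
have [n0 hn0] := averaging_eventually_le e20 N'1 alpha01 alpha_sum
  (fun n => sqr_ge0 `|x n - p|) hN'.
exists n0 => // n /hn0; rewrite mulrC divfK// distrC.
by rewrite ler_pXn2r ?nnegrE// ltW.
Qed.

End HalpernConvergence.

(** * Application to the algorithm *)

Theorem theorem13 (R : realType) (H : completeNormedModType R)
  (dot : {dot H for idfun})
  (dot_norm : forall x : H, dot x x = `|x| ^+ 2)
  (A : H -> set H) (A_maxmon : maximal_monotone dot A)
  (B : H -> H) (B_mon : monotone_map dot B)
  (L : R) (L_gt0 : 0 < L) (B_lip : L.-lipschitz B)
  (Omega_neq0 : zeros A B !=set0)
  (* (i) *)
  (alpha sigma : nat -> R)
  (alpha01 : forall n, (1 <= n)%N -> 0 < alpha n < 1)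
  (sigma01 : forall n, (1 <= n)%N -> 0 < sigma n < 1)
  (alpha_cvg0 : alpha n @[n --> \oo] --> (0 : R))
  (alpha_sum : (\sum_(1 <= n <oo) (alpha n)%:E = +oo)%E)
  (a b : R) (a_gt0 : 0 < a) (b_gt0 : 0 < b)
  (sigma_ab : forall n, (1 <= n)%N -> a < sigma n < b)
  (ab_sub : forall n, (1 <= n)%N ->
     [set` `]a, b[] `<=` [set` `]0, 1 - alpha n[])
  (* (ii) *)
  (eps eps' : nat -> R)
  (eps_gt0 : forall n, (1 <= n)%N -> 0 < eps n)
  (eps'_gt0 : forall n, (1 <= n)%N -> 0 < eps' n)
  (eps_le : forall n, (1 <= n)%N -> eps n <= eps' n)
  (eps'_sum : (\sum_(1 <= n <oo) (eps' n / alpha n)%:E < +oo)%E)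
  (* (iii) *)
  (barbeta bartheta : R)
  (barbeta_ge0 : 0 <= barbeta) (barbeta_le : barbeta <= bartheta)
  (bartheta_le1 : bartheta <= 1)
  (* parameters of the algorithm *)
  (mu gamma : R) (mu01 : 0 < mu < 1) (gamma02 : 0 < gamma < 2)
  (xi : nat -> R) (xi_ge0 : forall n, (1 <= n)%N -> 0 <= xi n)
  (xi_sum : (\sum_(1 <= n <oo) (xi n)%:E < +oo)%E)
  (* an infinite run; x 0 and x 1 are the arbitrary starting points *)
  (x z w y d u : nat -> H) (beta theta eta lambda : nat -> R)
  (lambda1_gt0 : 0 < lambda 1%N)
  (betaE : forall n, (1 <= n)%N ->
     beta n = inertial_weight barbeta (eps n) (x n) (x n.-1))
  (thetaE : forall n, (1 <= n)%N ->
     theta n = inertial_weight bartheta (eps' n) (x n) (x n.-1))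
  (zE : forall n, (1 <= n)%N -> z n = x n + beta n *: (x n - x n.-1))
  (wE : forall n, (1 <= n)%N -> w n = x n + theta n *: (x n - x n.-1))
  (yE : forall n, (1 <= n)%N ->
     y n = resolvent A (lambda n) (w n - lambda n *: B (w n)))
  (no_stop : forall n, (1 <= n)%N -> y n <> w n)
  (dE : forall n, (1 <= n)%N ->
     d n = w n - y n - lambda n *: (B (w n) - B (y n)))
  (etaE : forall n, (1 <= n)%N ->
     eta n = descent_coef dot (w n) (y n) (d n))
  (uE : forall n, (1 <= n)%N -> u n = w n - (gamma * eta n) *: d n)
  (xE : forall n, (1 <= n)%N ->
     x n.+1 = (1 - alpha n - sigma n) *: z n + sigma n *: u n)
  (lambdaE : forall n, (1 <= n)%N ->
     lambda n.+1 = next_stepsize B mu (lambda n) (xi n) (w n) (y n)) :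
  exists xstar : H,
    nearest_points (zeros A B) 0 = [set xstar] /\
    x n @[n --> \oo] --> xstar.
Proof.
have [p [Op pmin p_var]] :=
  zeros_min_norm dot_norm A_maxmon B_mon L_gt0 B_lip Omega_neq0.
exists p; split; first exact: (nearest_points_zeros dot_norm).
have [lmin [kappa [N [lmin0 k01 N1 l_ge contr]]]] :=
  stepsize_contraction L_gt0 B_lip mu01 xi_ge0 xi_sum lambda1_gt0 lambdaE.
have N0W n : (N <= n)%N -> (1 <= n)%N by apply: leq_trans.
have lam0 n : (1 <= n)%N -> 0 < lambda n by move=> /l_ge; exact: lt_le_trans.
have {etaE}uE n : (1 <= n)%N ->
    u n = w n - (gamma * descent_coef dot (w n) (y n) (d n)) *: d n.
  by move=> n1; rewrite uE// etaE.
pose c := gamma * (2 - gamma) * ((1 - kappa) / 2) ^+ 2.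
apply: (@halpern_cvg _ _ _ dot_norm alpha sigma eps' x z w u y p a c N) => //.
(* [sigma n] itself lies in the open interval [(a, b)], so the inclusion applied to it gives
   [sigma n < 1 - alpha n]. *)
- move=> n n1; have := ab_sub n n1 (sigma n).
  rewrite /= !in_itv /= sigma_ab// => /(_ isT)/andP[_ ->].
  by have /andP[-> _] := sigma_ab n n1.
- by move=> n n1; rewrite ltW// eps'_gt0.
(* As [eps n <= eps' n], the single sequence [eps'] bounds both inertial errors. *)
- move=> n n1; rewrite zE// addrAC subrr add0r betaE//.
  by apply: le_trans (eps_le n n1); apply: inertial_step => //; rewrite ltW// eps_gt0.
- move=> n n1; rewrite wE// addrAC subrr add0r thetaE//.
  by apply: inertial_step; [exact: le_trans barbeta_le|rewrite ltW// eps'_gt0].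
- have /andP[g0 g2] := gamma02; have /andP[_ k1] := k01.
  by rewrite !mulr_gt0 ?exprn_gt0 ?divr_gt0 ?subr_gt0.
- move=> n Nn; have n1 := N0W n Nn.
  exact: (relaxed_step_norm dot_norm gamma02 k01 (lam0 n n1)
    (contr n Nn) (no_stop n n1) (dE n n1) (uE n n1)).
- move=> n Nn; have n1 := N0W n Nn.
  exact: (relaxed_step_descent dot_norm A_maxmon B_mon gamma02 k01 (lam0 n n1)
    (contr n Nn) (yE n n1) (no_stop n n1) (dE n n1) (uE n n1) Op).
- move=> K rho /(p_var K)[delta delta0 hvar].
  (* From [|d n| <= 2 * |w n - y n|] and [lmin <= lambda n], the residual has norm at most
     [delta]. *)
  exists (delta * lmin / 2) => [|n Nn yK small]; first by rewrite divr_gt0 ?mulr_gt0.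
  have n1 := N0W n Nn; apply: (hvar _ ((lambda n)^-1 *: d n)) => //.
    exact: (residual_graph dot_norm A_maxmon (lam0 n n1) (yE n n1) (dE n n1)).
  rewrite normrZ normfV (gtr0_norm (lam0 n n1)) ler_pdivrMl ?lam0//.
  have := descent_norm k01 (lam0 n n1) (contr n Nn) (dE n n1).
  have := ler_wpM2r (ltW delta0) (l_ge n n1); move: small; lra.
Qed.
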